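(* Let $(X,\mu)$ be a non-atomic probability measure space and let $\mathcal{T}$ be a tree on $X$ with associated dyadic maximal operator $\mathcal{M}_{\mathcal{T}}$. Let $g:(0,1]\to[0,+\infty)$ be a non-increasing integrable function. Then for every $p>0$, $$\sup\left\{\int_X(\mathcal{M}_{\mathcal{T}}\phi)^p\,d\mu\ :\ \phi\in L^1(X,\mu),\ \phi\ge0,\ \phi^\ast=g\right\}=\int_0^1\left(\frac1t\int_0^t g(u)\,du\right)^p dt,$$ where both sides are elements of $[0,+\infty]$.
   Context: Tree: a set $\mathcal{T}$ of measurable subsets of $X$ is called a tree if: (1) $X\in\mathcal{T}$ and $\mu(I)>0$ for every $I\in\mathcal{T}$; (2) to every $I\in\mathcal{T}$ there corresponds a finite or countable subset $C(I)\subseteq\mathcal{T}$ containing at least two elements, such that the elements of $C(I)$ are pairwise disjoint subsets of $I$ and $I=\bigcup C(I)$; (3) $\mathcal{T}=\bigcup_{m\ge0}\mathcal{T}_{(m)}$, where $\mathcal{T}_{(0)}=\{X\}$ and $\mathcal{T}_{(m+1)}=\bigcup_{I\in\mathcal{T}_{(m)}}C(I)$; (4) $\lim_{m\to\infty}\sup_{I\in\mathcal{T}_{(m)}}\mu(I)=0$. Dyadic maximal operator: for $\phi\in L^1(X,\mu)$, $\mathcal{M}_{\mathcal{T}}\phi(x)=\sup\left\{\frac{1}{\mu(I)}\int_I|\phi|\,d\mu : x\in I\in\mathcal{T}\right\}$. For a measurable function $\psi$ on $X$, $\psi^\ast$ is its non-increasing rearrangement on $(0,1]$, i.e. the non-increasing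 function equimeasurable with $|\psi|$, for instance $\psi^\ast(t)=\inf\{s\ge0:\mu(\{|\psi|>s\})\le t\}$. Equalities between rearrangements (such as $\phi^\ast=g$) are understood almost everywhere. *)

(* Defs.v *)
From HB Require Import structures.
From mathcomp Require Import all_boot all_order all_algebra.
From mathcomp Require Import all_classical all_reals all_analysis.
Set Implicit Arguments.
Unset Strict Implicit.
Unset Printing Implicit Defensive.
Import Order.TTheory GRing.Theory Num.Theory.
Import numFieldNormedType.Exports.
Local Open Scope classical_set_scope.
Local Open Scope ring_scope.
Local Open Scope ereal_scope.

Definition nonatomic d (X : measurableType d) (R : realType)
    (mu : {measure set X -> \bar R}) : Prop :=
  forall A, measurable A -> 0 < mu A ->
    exists B, [/\ measurable B, B `<=` A, 0 < mu B & mu B < mu A].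

Fixpoint tree_level (X : Type) (C : set X -> set (set X)) (m : nat)
    : set (set X) :=
  if m is m'.+1 then \bigcup_(I in tree_level C m') C I else [set setT].

(* [C I] is only constrained for [I] in [Tr]. *)
Record tree_children d (X : measurableType d) (R : realType)
    (mu : {measure set X -> \bar R}) (Tr : set (set X))
    (C : set X -> set (set X)) : Prop := {
  tree_measurable : forall I, Tr I -> measurable I ;
  tree_root : Tr setT ;
  tree_gt0 : forall I, Tr I -> 0 < mu I ;
  tree_sub : forall I, Tr I -> C I `<=` Tr ;
  tree_countable : forall I, Tr I -> countable (C I) ;
  tree_two : forall I, Tr I -> exists J K, [/\ C I J, C I K & J <> K] ;
  tree_disjoint : forall I, Tr I -> trivIset (C I) id ;
  tree_cover : forall I, Tr I -> I = \bigcup_(J in C I) J ;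
  tree_levels : Tr = \bigcup_m tree_level C m ;
  tree_mesh : ereal_sup [set mu I | I in tree_level C m] @[m --> \oo] --> 0
}.

Definition is_tree d (X : measurableType d) (R : realType)
    (mu : {measure set X -> \bar R}) (Tr : set (set X)) : Prop :=
  exists C, tree_children mu Tr C.

Definition dyadic_maximal d (X : measurableType d) (R : realType)
    (mu : {measure set X -> \bar R}) (Tr : set (set X)) (phi : X -> R)
    (x : X) : \bar R :=
  ereal_sup [set (\int[mu]_(y in I) `|phi y|%:E) / mu I
            | I in [set I | Tr I /\ I x]].

Definition rearrangement d (X : measurableType d) (R : realType)
    (mu : {measure set X -> \bar R}) (psi : X -> R) (t : R) : \bar R :=
  ereal_inf [set s%:E
            | s in [set s : R | (0 <= s)%R /\
                                mu [set x | (s < `|psi x|)%R] <= t%:E]].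

(* Main.v *)
(* Upper bound: [{M phi > l}] is a disjoint union of nodes on which [phi] has
   average above [l], so that, with [t] its measure and [A t] the average of [g]
   over (0, t], [l * t <= t * A t]; as [A] is non-increasing, the distribution
   function of [M phi] lies below that of [A].

   Lower bound: ordering the children of every node lays the tree out as nested
   intervals, whence in each node [J] a nested family of unions of nodes of any
   prescribed measure. Fix [0 < q < 1]. Repeating this inside the nodes that make
   up the segment of relative measure [q] yields a nested family [B t] of measure
   [t] such that each [B (q ^ m)] is a union of nodes [K] across which every [B t]
   with [t <= q ^ m] is evenly spread. If [phi] takes the value [g t] where [x]
   enters the family at time [t], then [phi] has average [A (q ^ m)] over [K], so
   [M phi >= A (q ^ m)] on [B (q ^ m)], and the integrals agree up to a factor
   [q]. *)
Require Import Defs.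
From HB Require Import structures.
From mathcomp Require Import all_boot all_order all_algebra.
From mathcomp Require Import all_classical all_reals all_analysis.
From mathcomp Require Import measurable_realfun ring lra.
Set Implicit Arguments.
Unset Strict Implicit.
Unset Printing Implicit Defensive.
Import Order.TTheory GRing.Theory Num.Theory.
Import numFieldNormedType.Exports.
Local Open Scope classical_set_scope.
Local Open Scope ring_scope.
Local Open Scope ereal_scope.

(** * Integrals compared through superlevel sets *)

Lemma emeasurable_fun_gt d (T : measurableType d) (R : realType) (D : set T)
    (f : T -> \bar R) :
  (forall r : R, measurable (D `&` [set x | r%:E < f x])) -> measurable_fun D f.
Proof.
move=> mf; apply: (measurability _ (ErealGenOInfty.measurableE R)).
move=> _ [_ [r ->] <-]; rewrite [X in measurable X](_ : _ =
  D `&` [set x | r%:E < f x]) //.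
by apply/seteqP; split => x /=; rewrite in_itv/= andbT.
Qed.

Section layer_cake.
Context d (T : measurableType d) (R : realType).
Variable mu : {sigma_finite_measure set T -> \bar R}.
Local Notation leb := (@lebesgue_measure R).

(** Tonelli for the region under the graph of [f]: its section at [x] has length [f x], and its
    section at height [s] is a superlevel set. *)
Lemma layer_cake (f : T -> \bar R) : measurable_fun setT f ->
  (forall x, 0 <= f x) ->
  \int[mu]_x f x = \int[leb]_(s in `[0%R, +oo[) mu [set x | s%:E < f x].
Proof.
move=> mf f0.
pose GR := measurableTypeR R.
pose A : set (T * GR) := [set z | (0 <= z.2)%R /\ z.2%:E < f z.1].
have mA : measurable A.
  rewrite (_ : A = ((@snd T GR) @^-1` `[0%R, +oo[%classic) `&`
                    [set z | z.2%:E < f z.1]); last first.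
    by apply/seteqP; split => z; rewrite /A/= in_itv/= andbT.
  apply: measurableI.
    by rewrite -[X in measurable X]setTI; exact: measurable_snd.
  rewrite -[X in measurable X]setTI; apply: measurable_lte => //.
    by apply/measurable_EFinP; exact: measurable_snd.
  exact: measurableT_comp.
have := indic_fubini_tonelli mu (leb : {sigma_finite_measure set GR -> \bar R}) mA.
rewrite indic_fubini_tonelli_FE// indic_fubini_tonelli_GE//.
move=> H.
transitivity (\int[mu]_x (lebesgue_measure \o xsection A) x).
  apply: eq_integral => x _ /=.
  case fx: (f x) (f0 x) => [r| |] // r0.
  - rewrite (_ : xsection A x = `[0%R, r[%classic).
      rewrite lebesgue_measure_itv/= lte_fin; have [r0'|r0'] := ltP 0%R r.
        by rewrite oppr0 adde0.
      by apply/eqP; rewrite eq_le r0 lee_fin r0'.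
    apply/seteqP; split => s; rewrite /xsection/= in_setE /A/= fx lte_fin in_itv/=.
      by move=> [-> ->].
    by move=> /andP.
  - rewrite (_ : xsection A x = `[0%R, +oo[%classic).
      by rewrite lebesgue_measure_itv/= ltry oppr0 adde0.
    apply/seteqP; split => s; rewrite /xsection/= in_setE /A/= fx in_itv/= andbT.
      by move=> [-> ].
    by rewrite ltry.
rewrite H [in RHS]integral_mkcond; apply: eq_integral => s _ /=.
rewrite patchE; case: ifPn => [|]; rewrite ?inE ?notin_setE /= in_itv/= andbT => s0.
  congr (mu _); apply/seteqP; split => x; rewrite /ysection/= in_setE /A/=;
    last by [].
  by case.
rewrite (_ : ysection A s = set0) ?measure0//.
by apply/seteqP; split => x //; rewrite /ysection/= in_setE /A/= => -[].
Qed.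

End layer_cake.

Lemma setI_gt_restrict d (T : measurableType d) (R : realType) (D : set T)
    (f : T -> \bar R) (s : R) : (0 <= s)%R ->
  [set x | s%:E < (f \_ D) x] = D `&` [set x | s%:E < f x].
Proof.
move=> s0; apply/seteqP; split => x /=; rewrite patchE; case: ifPn => //.
- by rewrite inE.
- by move=> _; rewrite ltNge lee_fin s0.
- by move=> _ [].
- by rewrite notin_setE => nD [].
Qed.

(** By the layer cake formula, distribution functions decide. The two spaces may differ, so this
    carries the comparisons between [X] and []0, 1]]. *)
Lemma le_integral_superlevel d1 d2 (T1 : measurableType d1) (T2 : measurableType d2)
    (R : realType) (m1 : {sigma_finite_measure set T1 -> \bar R})
    (m2 : {sigma_finite_measure set T2 -> \bar R}) (D1 : set T1) (D2 : set T2)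
    (f : T1 -> \bar R) (h : T2 -> \bar R) (c : R) :
  measurable D1 -> measurable D2 -> measurable_fun D1 f -> measurable_fun D2 h ->
  (forall x, D1 x -> 0 <= f x) -> (forall x, D2 x -> 0 <= h x) -> (0 <= c)%R ->
  (forall s : R, (0 <= s)%R -> m1 (D1 `&` [set x | s%:E < f x]) <=
                               c%:E * m2 (D2 `&` [set x | s%:E < h x])) ->
  \int[m1]_(x in D1) f x <= c%:E * \int[m2]_(x in D2) h x.
Proof.
move=> mD1 mD2 mf mh f0 h0 c0 H.
rewrite integral_mkcond (integral_mkcond D2).
rewrite layer_cake; last 2 first.
- exact: (iffLR (measurable_restrictT _ mD1) mf).
- by move=> x; rewrite patchE; case: ifPn => //; rewrite inE; auto.
rewrite layer_cake; last 2 first.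
- exact: (iffLR (measurable_restrictT _ mD2) mh).
- by move=> x; rewrite patchE; case: ifPn => //; rewrite inE; auto.
have mlev d (T : measurableType d) (m : {sigma_finite_measure set T -> \bar R})
    (u : T -> \bar R) : measurable_fun setT u ->
    measurable_fun (`[0%R, +oo[%classic : set (measurableTypeR R)) (fun s => m
      [set x | s%:E < u x]).
  move=> mu; have nm : {in `[0%R, +oo[%classic &,
      {homo (fun s : R => m [set x | s%:E < u x]) : x y / (x <= y)%R >-> y <= x}}.
    move=> x y _ _ xy; apply: le_measure; rewrite ?inE.
    - by rewrite -[X in measurable X]setTI; exact: emeasurable_fun_o_infty.
    - by rewrite -[X in measurable X]setTI; exact: emeasurable_fun_o_infty.
    - by move=> z /=; apply: le_lt_trans; rewrite lee_fin.
  (* A level function is non-increasing on [[0, +oo[], so its superlevel sets there are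
     intervals. *)
  apply: emeasurable_fun_gt => r; apply: is_interval_measurable.
  move=> x y [/= xi xr] [/= yi yr] z /andP[xz zy]; split => /=.
    by move: xi; rewrite /= !in_itv/= !andbT => /le_trans; apply.
  apply: (lt_le_trans yr); apply: nm => //; rewrite inE//.
  by move: xi; rewrite /= !in_itv/= !andbT => /le_trans; apply.
rewrite -ge0_integralZl//; last first.
- by apply: mlev; exact: (iffLR (measurable_restrictT _ mD2) mh).
apply: ge0_le_integral => //.
- by apply: mlev; exact: (iffLR (measurable_restrictT _ mD1) mf).
- apply/measurable_funeM; apply: mlev;
  exact: (iffLR (measurable_restrictT _ mD2) mh).
- move=> s /=; rewrite in_itv/= andbT => s0.
  rewrite !setI_gt_restrict//; exact: H.
Qed.

(** [{f > s}] is the increasing union of the sets [{f > s + 1/(n+1)}]. This makes room for a strict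
    inequality between levels in the upper bound. *)
Lemma measure_superlevel_rcont d (T : measurableType d) (R : realType)
    (mu : {measure set T -> \bar R}) (D : set T) (f : T -> \bar R) (s : R) (r :
      \bar R) :
  measurable D -> measurable_fun D f ->
  (forall s' : R, (s < s')%R -> mu (D `&` [set x | s'%:E < f x]) <= r) ->
  mu (D `&` [set x | s%:E < f x]) <= r.
Proof.
move=> mD mf H.
pose F n := D `&` [set x | (s + n.+1%:R^-1)%:E < f x].
have mF n : measurable (F n) by exact: emeasurable_fun_o_infty.
have FE : \bigcup_n F n = D `&` [set x | s%:E < f x].
  apply/seteqP; split => [x [n _ [Dx /=]]|x [Dx /= sx]].
    move=> sn; split => //=; apply: le_lt_trans sn; rewrite lee_fin lerDl.
    by rewrite invr_ge0.
  have [e e0 se] : exists2 e : R, (0 < e)%R & (s + e)%:E < f x.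
    case: (f x) sx => [t|_|//]; last by exists 1%R => //; rewrite ltry.
    rewrite lte_fin => st; exists ((t - s) / 2)%R; first by lra.
    by rewrite lte_fin; lra.
  have := near_infty_natSinv_lt (PosNum e0) => -[n _ /(_ n (leqnn n)) /= ne].
  exists n => //; split => //=; apply: le_lt_trans se.
  by rewrite lee_fin lerD2l ltW.
have ndF : nondecreasing_seq F.
  move=> m n mn; apply/subsetPset => x [Dx /= mx]; split => //=.
  apply: le_lt_trans mx; rewrite lee_fin lerD2l lef_pV2 ?posrE//.
  by rewrite ler_nat ltnS.
have := @nondecreasing_cvg_mu _ _ _ mu _ mF (bigcupT_measurable _ mF) ndF.
rewrite FE => cF; rewrite -(cvg_lim _ cF)//.
apply: lime_le; first exact: cvgP cF.
apply: nearW => n; apply: H; rewrite ltrDl invr_gt0; exact: ltr0Sn.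
Qed.

(** * Trees whose nodes have integer addresses *)

Section indexed_tree.
Context d (X : measurableType d) (R : realType) (mu : probability X R).
Implicit Types (Tr : set (set X)) (I J K : set X) (ch : set X -> nat -> set X).

(* The children of every node are indexed by [nat], padded with [set0]. *)
Record indexed_tree Tr ch : Prop := {
  it_root : Tr setT ;
  it_measurable : forall I, Tr I -> measurable I ;
  it_gt0 : forall I, Tr I -> 0 < mu I ;
  it_sub : forall I n, ch I n `<=` I ;
  it_triv : forall I, trivIset setT (ch I) ;
  it_cover : forall I, Tr I -> \bigcup_n ch I n = I ;
  it_child : forall I n, ch I n !=set0 -> Tr (ch I n) ;
  it_reach : forall I, Tr I -> exists s, I = foldl ch setT s ;
  it_mesh : forall e : R, (0 < e)%R -> exists M, forall s, (M <= size s)%N ->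
    mu (foldl ch setT s) <= e%:E }.

Lemma tree_indexed Tr : is_tree mu Tr -> exists ch, indexed_tree Tr ch.
Proof.
move=> [C HC].
have /choice[idx idxP] : forall I, exists f : set X -> nat,
    Tr I -> {in C I &, injective f}.
  move=> I.
  have [TI|] := pselect (Tr I); last by exists (fun=> 0%N).
  by have /countable_injP[f finj] := tree_countable HC TI; exists f.
(* The guard [Tr I] makes every child of a non-node empty, so inclusion and disjointness of children
   hold for arbitrary [I]. *)
pose ch I n : set X := [set x | exists K, [/\ Tr I, C I K, idx I K = n & K x]].
have chE I K : Tr I -> C I K -> ch I (idx I K) = K.
  move=> TI CK; apply/seteqP; split => [x [K' [_ CK' e K'x]]|x Kx].
    by rewrite -(idxP _ TI K' K) ?inE.
  by exists K.
have chN0 I n : ch I n !=set0 -> Tr I /\ C I (ch I n).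
  by move=> [x [K [TI CK <- Kx]]]; rewrite chE.
have sub I n : ch I n `<=` I.
  move=> x [K [TI CK _ Kx]]; rewrite (tree_cover HC TI); by exists K.
(* An address of a nonempty set has never left the tree, so its length is the level of that set. *)
have lev s : foldl ch setT s !=set0 -> tree_level C (size s) (foldl ch setT s).
  elim/last_ind: s => [|s n IH] //; rewrite size_rcons foldl_rcons => N0.
  have [TI CI] := chN0 _ _ N0; exists (foldl ch setT s) => //; apply: IH.
  by case: N0 => x /sub; exists x.
exists ch; split => //.
- exact: tree_root HC.
- exact: tree_measurable HC.
- exact: tree_gt0 HC.
- move=> I i j _ _ [x [[K [TI CK <- Kx]] [K' [_ CK' <- K'x]]]].
  by rewrite (tree_disjoint HC TI CK CK')//; exists x.
- move=> I TI; apply/seteqP; split => [x [n _ /sub]//|x].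
  rewrite {1}(tree_cover HC TI) => -[K CK Kx].
  by exists (idx I K) => //; exists K.
- by move=> I n /chN0[TI]; exact: (tree_sub HC TI).
- move=> I; rewrite {1}(tree_levels HC) => -[m _].
  elim: m I => [|m IH] I /=; first by move=> ->; exists [::].
  move=> [J lJ CJI]; have [s sJ] := IH _ lJ; exists (rcons s (idx J I)).
  rewrite foldl_rcons -sJ chE//.
  by rewrite (tree_levels HC); exists m.
- move=> e e0.
  have /fine_cvgP[] := tree_mesh HC.
  move=> [M1 _ H1] /cvgr0Pnorm_lt /(_ e e0)[M2 _ H2].
  (* Beyond [M1] the supremum of the level is finite, so [fine] is faithful; beyond [M2] it is below
     [e]. *)
  exists (maxn M1 M2) => s; rewrite geq_max => /andP[M1s M2s].
  have [N0|/set0P/negP/negPn/eqP->] := pselect (foldl ch setT s !=set0); last first.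
    by rewrite measure0 lee_fin ltW.
  have := H2 _ M2s => /=; set S := ereal_sup _ => Se.
  apply: (@le_trans _ _ S); first by apply: ereal_sup_ubound;
    exists (foldl ch setT s) => //; exact: lev.
  have /fineK <- : S \is a fin_num := H1 _ M1s.
  by rewrite lee_fin (le_trans (ler_norm _))// ltW.
Qed.

(** * Fronts of stopped descents and the weak type inequality *)

Section nodes.
Variables (Tr : set (set X)) (ch : set X -> nat -> set X).
Hypothesis HT : indexed_tree Tr ch.
Implicit Types (stop : set X -> R -> bool) (t : R) (s : seq nat).

(** The left endpoint of the [n]-th child when [I] is laid out as an interval. *)
Definition offset I n : R := (\sum_(j < n) fine (mu (ch I j)))%R.

(* [frontier stop I t s] is the node of address [s] below [I] if the descent
   from [I] along [s] meets [stop] there for the first time, and [set0]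
   otherwise; [t] is what remains of the threshold once the measure of the
   elder siblings has been subtracted. *)
Fixpoint frontier stop I t s : set X :=
  if stop I t then (if s is [::] then I else set0)
  else if s is n :: s' then frontier stop (ch I n) (t - offset I n) s' else set0.

(** Addresses are coded by integers so that countable additivity over sequences applies; an integer
    that codes no address yields [set0]. *)
Definition piece stop I t (i : nat) : set X :=
  oapp (frontier stop I t) set0 (pickle_inv i).

Definition front stop I t : set X := \bigcup_i piece stop I t i.

Lemma frontier_sub stop I t s : frontier stop I t s `<=` I.
Proof.
elim: s I t => [|n s IH] I t /=; case: ifP => _ // x //.
by move=> /IH; exact: (it_sub HT).
Qed.

(** Addresses that diverge lead into disjoint siblings, and of two addresses one of which extends
    the other, at most one ends at the first stop. *)
Lemma frontier_inj stop I t s s' x :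
  frontier stop I t s x -> frontier stop I t s' x -> s = s'.
Proof.
elim: s s' I t => [|n s IH] [|n' s'] I t //=; case: ifP => // _ fx fx'.
have nn' : n = n'.
  apply: (@it_triv _ _ HT I n n') => //; exists x; split.
    exact: frontier_sub fx.
  exact: frontier_sub fx'.
by rewrite -{}nn' in fx' *; rewrite (IH _ _ _ fx fx').
Qed.

Lemma child_node I n : ch I n = set0 \/ Tr (ch I n).
Proof.
have [/(it_child HT)|/set0P/negP/negPn/eqP] := pselect (ch I n !=set0).
  by right.
by left.
Qed.

Lemma frontier_node stop I t s : Tr I ->
  frontier stop I t s = set0 \/ Tr (frontier stop I t s).
Proof.
have : Tr I -> I = set0 \/ Tr I by right.
move=> /[apply]; elim: s I t => [|n s IH] I t TI /=; case: ifP => // _; try by left.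
exact/IH/child_node.
Qed.

Lemma frontier_stop stop I t s x : frontier stop I t s x ->
  exists t', stop (frontier stop I t s) t'.
Proof.
elim: s I t => [|n s IH] I t /=; case: ifP => //; first by exists t.
by move=> _; exact: IH.
Qed.

Lemma frontP stop I t x : front stop I t x <-> exists s, frontier stop I t s x.
Proof.
split=> [[i _]|[s fx]].
  by rewrite /piece; case: pickle_inv => //= s; exists s.
by exists (pickle s) => //; rewrite /piece pickleK_inv.
Qed.

Lemma piece_triv stop I t : trivIset setT (piece stop I t).
Proof.
move=> i j _ _ [x []]; rewrite /piece.
have := @pickle_invK (seq nat) i; case: pickle_inv => //= s <-.
have := @pickle_invK (seq nat) j; case: pickle_inv => //= s' <-.
by move=> fs fs'; rewrite (frontier_inj fs fs').
Qed.

Lemma piece_node stop I t i : Tr I ->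
  piece stop I t i = set0 \/ Tr (piece stop I t i).
Proof.
by rewrite /piece; case: pickle_inv => [s|] /=; [exact: frontier_node|left].
Qed.

Lemma node_measurable I : I = set0 \/ Tr I -> measurable I.
Proof. by move=> [->//|]; exact: (it_measurable HT). Qed.

Lemma piece_measurable stop I t i : Tr I -> measurable (piece stop I t i).
Proof. by move=> TI; apply/node_measurable/piece_node. Qed.

Lemma front_measurable stop I t : Tr I -> measurable (front stop I t).
Proof. by move=> TI; apply: bigcupT_measurable => i; exact: piece_measurable. Qed.

Lemma front_sub stop I t : front stop I t `<=` I.
Proof. by move=> x /frontP[s]; exact: frontier_sub. Qed.

Lemma foldl_sub I s : foldl ch I s `<=` I.
Proof. by elim: s I => [I x //|n s IH I x /= /IH]; exact: (it_sub HT). Qed.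

(** A node with average above [l] is reached by some address; the descent along it stops there or at
    an ancestor, which contains the node. *)
Lemma maximal_superlevel (phi : X -> R) (l : R) :
  let stop I (_ : R) := l%:E < (\int[mu]_(y in I) `|phi y|%:E) / mu I in
  [set x | l%:E < dyadic_maximal mu Tr phi x] = front stop setT 0.
Proof.
move=> stop; apply/seteqP; split => x.
  move=> /ereal_sup_gt[_ [I [TI Ix] <-]] lI.
  have [s sI] := it_reach HT TI; apply/frontP.
  have : stop (foldl ch setT s) 0%R /\ foldl ch setT s x by rewrite -sI.
  move: (setT) 0%R => J t.
  clear TI Ix lI sI; elim: s J t => {I} [|n s IH] I t /= [stI Ix];
    first by exists [::]; rewrite /= ifT.
  have [stt|stt] := boolP (stop I t).
    by exists [::] => /=; rewrite stt; exact: (it_sub HT (foldl_sub Ix)).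
  have [//|s' s'x] := IH (ch I n) (t - offset I n)%R.
  by exists (n :: s') => /=; rewrite (negbTE stt).
move=> /frontP[s fx]; have [t /= st] := frontier_stop fx.
apply: (lt_le_trans st); apply: ereal_sup_ubound;
  exists (frontier stop setT 0 s) => //.
split => //; have [f0|//] := frontier_node stop 0 s (it_root HT).
by move: fx; rewrite f0.
Qed.

Lemma maximal_measurable (phi : X -> R) :
  measurable_fun setT (dyadic_maximal mu Tr phi).
Proof.
apply: emeasurable_fun_gt => r; rewrite setTI maximal_superlevel.
by apply: front_measurable; exact: it_root HT.
Qed.

Lemma maximal_ge0 (phi : X -> R) x : 0 <= dyadic_maximal mu Tr phi x.
Proof.
apply: le_trans (ereal_sup_ubound _); last by exists setT => //; split => //;
  exact: it_root HT.
by rewrite mule_ge0 ?inve_ge0// integral_ge0.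
Qed.

(** Each nonempty piece [K] of the front satisfies [l * mu K <= \int_K |phi|]; these inequalities
    are summed over the disjoint pieces. *)
Lemma maximal_weak_type (phi : X -> R) (l : R) : (0 <= l)%R ->
  measurable_fun setT phi ->
  l%:E * mu [set x | l%:E < dyadic_maximal mu Tr phi x] <=
  \int[mu]_(x in [set x | l%:E < dyadic_maximal mu Tr phi x]) `|phi x|%:E.
Proof.
move=> l0 mphi; rewrite maximal_superlevel; set stop := fun _ _ => _.
have mp i : measurable (piece stop setT 0 i).
  by apply: piece_measurable; exact: it_root HT.
rewrite [in X in X <= _]/front measure_semi_bigcup//; last 2 first.
- exact: piece_triv.
- exact: bigcupT_measurable.
rewrite ge0_integral_bigcup//; last 2 first.
- by apply/measurable_funTS/measurable_EFinP; exact: measurableT_comp.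
- exact: piece_triv.
rewrite -nneseriesZl//; apply: lee_nneseries => [i _ _|i _].
  by rewrite mule_ge0.
have [->|TK] := piece_node stop 0 i (it_root HT).
  by rewrite measure0 mule0 integral_set0.
have /set0P[x Kx] : piece stop setT 0 i != set0.
  by apply/eqP => K0; have := it_gt0 HT TK; rewrite K0 measure0 ltxx.
have [t] : exists t, stop (piece stop setT 0 i) t.
  by move: Kx; rewrite /piece; case: pickle_inv => //= s; exact: frontier_stop.
move: (piece stop setT 0 i) TK (mp i) => K TK mK /ltW.
have Kf := fin_num_measure mu _ mK.
have K0 : (0 < fine (mu K))%R by rewrite fine_gt0// (it_gt0 HT TK)/= ltey_eq Kf.
by rewrite -{1}(fineK Kf) inver gt_eqF// lee_pdivlMr// fineK.
Qed.

End nodes.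
End indexed_tree.

(** * Initial segments of a node and their measure *)

Section initial_segments.
Context d (X : measurableType d) (R : realType) (mu : probability X R).
Variables (Tr : set (set X)) (ch : set X -> nat -> set X).
Hypothesis HT : indexed_tree mu Tr ch.
Implicit Types (I J K : set X) (t : R) (s : seq nat).

Local Notation w I := (fine (mu I)).

Lemma fine_measureK A : measurable A -> (w A)%:E = mu A.
Proof. by move=> mA; rewrite fineK// fin_num_measure. Qed.

Lemma offsetS I n : offset mu ch I n.+1 = (offset mu ch I n + w (ch I n))%R.
Proof. by rewrite /offset big_ord_recr. Qed.

Lemma offset_le I m n : (m <= n)%N -> (offset mu ch I m <= offset mu ch I n)%R.
Proof.
move=> /subnK <-; elim: (n - m)%N => // k IH.
by rewrite addSn offsetS (le_trans IH)// lerDl fine_ge0.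
Qed.

(* The initial segment of measure [t] of [I], when [I] is laid out as an interval
   divided among its children in their order. *)
Definition below I t : set X := front mu ch (fun I t => w I <= t)%R I t.

Lemma below_full I t : (w I <= t)%R -> below I t = I.
Proof.
move=> It; apply/seteqP; split; first exact: (front_sub HT).
by move=> x Ix; apply/frontP; exists [::] => /=; rewrite It.
Qed.

Lemma below_step I t : (t < w I)%R ->
  below I t = \bigcup_n below (ch I n) (t - offset mu ch I n).
Proof.
rewrite ltNge => It; apply/seteqP; split => x.
  move=> /frontP[[|n s]] /=; rewrite (negbTE It)// => fx.
  by exists n => //; apply/frontP; exists s.
move=> [n _ /frontP[s fx]]; apply/frontP; exists (n :: s) => /=.
by rewrite (negbTE It).
Qed.

Lemma below_lt0 I t : (t < 0)%R -> below I t = set0.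
Proof.
move=> t0; apply/seteqP; split => x // /frontP[s].
elim: s I t t0 => [|n s IH] I t t0 /=; rewrite leNgt (lt_le_trans t0) ?fine_ge0//=.
apply: IH; rewrite ltrBlDr add0r (lt_le_trans t0)//.
by apply: sumr_ge0 => j _; rewrite fine_ge0.
Qed.

Lemma below_mono I t t' : (t <= t')%R -> below I t `<=` below I t'.
Proof.
move=> tt' x /frontP[s fx]; apply/frontP.
elim: s I t t' tt' fx => [|n s IH] I t t' tt' /=.
  case: ifP => // It Ix; exists [::] => /=.
  by rewrite (le_trans It).
case: ifP => // It fx; have [It'|It'] := boolP (w I <= t')%R.
  by exists [::] => /=; rewrite It'; exact: (it_sub HT (frontier_sub HT fx)).
have [|s' fx'] :=
  IH (ch I n) (t - offset mu ch I n)%R (t' - offset mu ch I n)%R _ fx.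
  by rewrite lerD2r.
by exists (n :: s') => /=; rewrite (negbTE It').
Qed.

Lemma below_measurable I t : Tr I -> measurable (below I t).
Proof. exact: (front_measurable HT). Qed.

(** By countable additivity the offsets increase to the measure of [I], so some offset exceeds [t];
    the least such index is positive because [0 <= t]. *)
Lemma straddle I t : Tr I -> (0 <= t < w I)%R ->
  exists n, (offset mu ch I n <= t < offset mu ch I n.+1)%R.
Proof.
move=> TI /andP[t0 tI].
have mI := it_measurable HT TI.
have mch n : measurable (ch I n) by apply: (node_measurable HT);
  exact: (child_node HT).
have ex : exists n, (t < offset mu ch I n)%R.
  apply: contrapT => H; move: tI; apply/negP;
    rewrite -leNgt -lee_fin fine_measureK//.
  rewrite -(it_cover HT TI) measure_semi_bigcup//; last 2 first.
    exact: it_triv HT I.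
    exact: bigcupT_measurable.
  apply: lime_le; first exact: is_cvg_nneseries.
  apply: nearW => n; rewrite big_mkord.
  rewrite (eq_bigr (fun i : 'I_n => (w (ch I i))%:E)); last by move=> i _;
    rewrite fine_measureK.
  rewrite sumEFin lee_fin leNgt; apply/negP => tn; apply: H; by exists n.
case: (ex_minnP ex) => -[|n].
  by rewrite /offset big_ord0 ltNge t0.
move=> tn min; exists n; rewrite tn andbT leNgt; apply/negP => /min.
by rewrite ltnn.
Qed.

(** Children before the [n]-th receive a threshold at least their own measure and are taken whole;
    those after it receive a negative one and are left out. *)
Lemma measure_below_straddle I t n : Tr I -> (0 <= t < w I)%R ->
  (offset mu ch I n <= t < offset mu ch I n.+1)%R ->
  mu (below I t) = (offset mu ch I n)%:E + mu (below (ch I n) (t - offset mu ch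
    I n)).
Proof.
move=> TI /andP[t0 tI] /andP[nt tn].
have mch j : measurable (ch I j) by apply: (node_measurable HT);
  exact: (child_node HT).
have -> : below I t =
    \big[setU/set0]_(j < n) ch I j `|` below (ch I n) (t - offset mu ch I n).
  rewrite below_step//; apply/seteqP; split => x.
    move=> [j _]; case: (ltngtP j n) => [jn|nj|->].
    - move=> /(front_sub HT) jx; left; rewrite -bigcup_mkord; by exists j.
    - rewrite below_lt0// subr_lt0 (lt_le_trans tn)//; exact: offset_le.
    - by right.
  rewrite -bigcup_mkord => -[[j /= jn jx]|nx]; last by exists n.
  exists j => //; rewrite below_full// lerBrDl -offsetS (le_trans _ nt)//.
  exact: offset_le.
rewrite measureU//.
- congr (_ + _); rewrite measure_bigsetU//.
  + rewrite (eq_bigr (fun i : 'I_n => (w (ch I i))%:E)); last by move=> i _;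
    rewrite fine_measureK.
    by rewrite sumEFin.
  + exact: it_triv HT I.
- exact: bigsetU_measurable.
- have [->|TJ] := child_node HT I n; last exact: below_measurable.
  have -> : below set0 (t - offset mu ch I n) = set0; last exact: measurable0.
  by apply/seteqP; split => // x /(front_sub HT).
- apply/seteqP; split => x // [].
  rewrite -bigcup_mkord => -[j /= jn jx] /(front_sub HT) nx.
  have jnE : j = n by apply: (@it_triv _ _ _ _ _ _ HT I) => //; exists x.
  by move: jn; rewrite jnE ltnn.
Qed.

(* [below I t] cuts a single child of [I]: the error is that of this child. *)
Lemma measure_below_mesh m I s0 t : Tr I -> I = foldl ch setT s0 ->
  (0 <= t < w I)%R -> exists s, size s = (size s0 + m)%N /\
    (`|w (below I t) - t| <= w (foldl ch setT s))%R.
Proof.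
elim: m I s0 t => [|m IH] I s0 t TI Is0 tI; have /andP[t0 tI'] := tI.
  exists s0; rewrite addn0 -Is0; split => //.
  have b0 : (0 <= w (below I t))%R by rewrite fine_ge0.
  have bI : (w (below I t) <= w I)%R.
    rewrite fine_le ?fin_num_measure//; try exact: below_measurable.
    - exact: (it_measurable HT TI).
    apply: le_measure; rewrite ?inE;
      [exact: below_measurable|exact: (it_measurable HT TI)|].
    exact: (front_sub HT).
  by rewrite ler_norml; lra.
have [n nP] := straddle TI tI; have /andP[nt tn] := nP.
have TJ : Tr (ch I n).
  have [J0|//] := child_node HT I n.
  by move: tn; rewrite offsetS J0 measure0/= addr0 ltNge nt.
have mb := measure_below_straddle TI tI nP.
have [||s [ss sP]] := IH (ch I n) (rcons s0 n) (t - offset mu ch I n)%R TJ.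
- by rewrite foldl_rcons -Is0.
- by rewrite subr_ge0 nt ltrBlDl -offsetS.
exists s; rewrite ss size_rcons addSnnS; split => //.
apply: le_trans sP; rewrite mb fineD//; last first.
  by rewrite fin_num_measure//; exact: below_measurable.
by rewrite opprB /= addrCA addrA.
Qed.

(** The error is at most the measure of a node at any chosen depth, and the mesh tends to 0. The
    endpoint [t = w I] is apart because no child straddles it. *)
Lemma measure_below I t : Tr I -> (0 <= t <= w I)%R -> mu (below I t) = t%:E.
Proof.
move=> TI /andP[t0]; rewrite le_eqVlt => /predU1P[->|tI].
  by rewrite below_full// fine_measureK//; exact: (it_measurable HT TI).
rewrite -fine_measureK; last exact: below_measurable.
congr EFin; apply/eqP; rewrite -subr_eq0 -normr_le0; apply/ler_addgt0Pl => e e0.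
have [M HM] := it_mesh HT e0; have [s0 Is0] := it_reach HT TI.
rewrite addr0; have [|s [ss]] := measure_below_mesh M TI Is0 (t := t).
  by rewrite t0.
move/le_trans; apply; rewrite -lee_fin fine_measureK.
  by apply: HM; rewrite ss leq_addl.
apply: (node_measurable HT); elim/last_ind: {ss} s => [|s n _].
  by right; exact: it_root HT.
by rewrite foldl_rcons; exact: (child_node HT).
Qed.

End initial_segments.

(** * Nested families evenly spread over nodes *)

Section spreads.
Context d (X : measurableType d) (R : realType) (mu : probability X R).
Variables (Tr : set (set X)) (ch : set X -> nat -> set X).
Hypothesis HT : indexed_tree mu Tr ch.
Implicit Types (I J K : set X) (t : R) (B : R -> set X).

(* [B] is a nested family filling [J] at unit speed; the depth [N] bounds the
   powers [q ^+ m] at which [B (q ^+ m)] is a union of nodes of the tree each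
   filled by [B] at the same speed. *)
Record spread (q : R) (N : nat) J B : Prop := {
  sp_measurable : forall t, measurable (B t) ;
  sp_sub : forall t, B t `<=` J ;
  sp_mono : forall t t', (t <= t')%R -> B t `<=` B t' ;
  sp_full : B 1%R = J ;
  sp_measure : forall t, (0 <= t <= 1)%R -> mu (B t) = t%:E * mu J ;
  sp_node : forall m x, (m <= N)%N -> B (q ^+ m)%R x -> exists K,
    [/\ Tr K, K x, K `<=` J & forall t, (0 <= t <= q ^+ m)%R ->
        mu (B t `&` K) = (t / q ^+ m)%:E * mu K] }.

Lemma spread0 q N : spread q N set0 (fun=> set0).
Proof.
by split => // [t x|t t' _ x|t _] //; rewrite measure0 mule0.
Qed.

(** At depth 0 the only power is [q ^+ 0 = 1], for which [J] itself is the required node. *)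
Lemma below_spread q J : Tr J -> spread q 0 J (fun t => below mu ch J (t * fine
  (mu J))).
Proof.
move=> TJ; have mJ := it_measurable HT TJ.
have mB t : (0 <= t <= 1)%R -> mu (below mu ch J (t * fine (mu J))) = t%:E * mu J.
  move=> /andP[t0 t1]; rewrite (measure_below HT)//.
    by rewrite EFinM fine_measureK.
  by rewrite mulr_ge0 ?fine_ge0//= ler_piMl// fine_ge0.
split => //.
- by move=> t; exact: (below_measurable HT).
- by move=> t; exact: (front_sub HT).
- by move=> t t' tt'; apply: (below_mono HT); rewrite ler_wpM2r ?fine_ge0.
- by rewrite mul1r; exact: (below_full HT).
- move=> [|//] x _ Bx; exists J; split => //; first exact: (front_sub HT) Bx.
  move=> t; rewrite expr0 divr1 => t1; rewrite setIidl; first exact: mB.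
  exact: (front_sub HT).
Qed.

(** Induction on the depth: after time [q] the initial segments of [J] are kept; up to time [q] each
    node composing the segment at [q] is filled by its own spread of depth [N], run on the clock
    [t / q]. *)
Lemma exists_spread q N J : (0 < q < 1)%R -> Tr J -> exists B, spread q N J B.
Proof.
move=> /andP[q0 q1].
have : Tr J -> J = set0 \/ Tr J by right.
move=> /[apply]; elim: N J => [|N IH] J.
  move=> [->|TJ]; first by exists (fun=> set0); exact: spread0.
  by exists (fun t => below mu ch J (t * fine (mu J))); exact: below_spread.
move=> [->|TJ]; first by exists (fun=> set0); exact: spread0.
have S0 := below_spread q TJ; set B0 := fun t => _ in S0.
pose Kp := piece mu ch (fun I t => fine (mu I) <= t)%R J (q * fine (mu J)).
have B0q : B0 q = \bigcup_i Kp i by [].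
have Ktriv : trivIset setT Kp by exact: (piece_triv HT).
have /choice[Bi BiP] : forall i, exists B, spread q N (Kp i) B.
  by move=> i; apply: IH; exact: (piece_node HT).
pose B t := if (t <= q)%R then \bigcup_i Bi i (t / q)%R else B0 t.
have Bitriv t : trivIset setT (Bi^~ t).
  move=> i j _ _ [x [xi xj]]; apply: Ktriv => //; exists x.
  by split; [exact: (sp_sub (BiP i)) xi|exact: (sp_sub (BiP j)) xj].
have Bmeas t : (0 <= t <= 1)%R -> mu (B t) = t%:E * mu J.
  move=> /andP[t0 t1]; rewrite /B; case: ifPn => [tq|_]; last first.
    by apply: (sp_measure S0); rewrite t0.
  have tq1 : (0 <= t / q <= 1)%R by rewrite divr_ge0 ?(ltW q0)//= ler_pdivrMr//
    mul1r.
  rewrite measure_semi_bigcup//; last 2 first.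
  - by move=> i; exact: (sp_measurable (BiP i)).
  - by apply: bigcupT_measurable => i; exact: (sp_measurable (BiP i)).
  rewrite (eq_eseriesr (fun i _ => sp_measure (BiP i) tq1)).
  rewrite nneseriesZl// -measure_semi_bigcup//; last 2 first.
  - by move=> i; exact: (piece_measurable HT).
  - by apply: bigcupT_measurable => i; exact: (piece_measurable HT).
  rewrite -B0q [X in _ * X](_ : _ = q%:E * mu J); last first.
    by apply: (sp_measure S0); rewrite (ltW q0) (ltW q1).
  by rewrite muleA -EFinM divfK// gt_eqF.
have Bsub t : B t `<=` J.
  rewrite /B; case: ifP => _; last exact: (sp_sub S0).
  move=> x [i _ /(sp_sub (BiP i)) Kx]; apply: (sp_sub S0 (t := q)).
  by rewrite B0q; exists i.
exists B; split => //.
- move=> t; rewrite /B; case: ifP => _; last exact: (sp_measurable S0).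
  by apply: bigcupT_measurable => i; exact: (sp_measurable (BiP i)).
- move=> t t' tt'; rewrite /B; case: ifPn => tq; case: ifPn => t'q.
  + move=> x [i _ ix]; exists i => //; apply: (sp_mono (BiP i)) ix.
    by rewrite ler_pM2r// invr_gt0.
  + rewrite -ltNge in t'q => x [i _ /(sp_sub (BiP i)) Kx].
    by apply: (sp_mono S0 (ltW t'q)); rewrite B0q; exists i.
  + by move: tq; rewrite (le_trans tt' t'q).
  + exact: (sp_mono S0).
- by rewrite /B leNgt q1 (sp_full S0).
- move=> [|m] x mN.
    move=> Bx; exists J; split => //; first exact: Bsub Bx.
    move=> t; rewrite expr0 divr1 => t1; rewrite setIidl; first exact: Bmeas.
    exact: Bsub.
  have qm0 : (0 < q ^+ m)%R by rewrite exprn_gt0.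
  have qm1 : (q ^+ m <= 1)%R by rewrite exprn_ile1// ltW.
  have qmq : (q ^+ m.+1 <= q)%R by rewrite exprS ler_piMr// ltW.
  rewrite {1}/B qmq => -[i _]; rewrite exprS mulrAC divff ?gt_eqF// mul1r => ix.
  have [K [TK Kx KJ KE]] := sp_node (BiP i) mN ix.
  have KiJ : Kp i `<=` J by move=> y Ky; apply: (sp_sub S0 (t := q));
    rewrite B0q; exists i.
  exists K; split => //; first by move=> y /KJ/KiJ.
  move=> t /andP[t0 tqm].
  have tq : (t <= q)%R by rewrite (le_trans tqm)// -exprS.
  (* [K] lies in the piece [Kp i], so the spreads of the other pieces do not meet it. *)
  rewrite (_ : B t `&` K = Bi i (t / q) `&` K)%R; last first.
    rewrite /B tq; apply/seteqP; split => y [].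
      move=> [j _ jy] Ky; split => //; rewrite (_ : i = j)//.
      apply: Ktriv => //; exists y; split; first exact: KJ.
      exact: (sp_sub (BiP j)) jy.
    by move=> iy Ky; split => //; exists i.
  rewrite KE; first by rewrite invfM mulrA.
  rewrite divr_ge0 ?(ltW q0)//= ler_pdivrMr// mulrC.
  exact: tqm.
Qed.

End spreads.

(** * Powers and initial subsets of the unit interval *)

Lemma lt_poweR_root (R : realType) (p s : R) (x : \bar R) :
  (0 < p)%R -> (0 <= s)%R -> 0 <= x ->
  (s%:E < x `^ p) = ((s `^ p^-1)%:E < x).
Proof.
move=> p0 s0; case: x => [x| |] //; last by rewrite poweRyr ?gt_eqF// !ltry.
rewrite lee_fin => x0; rewrite poweR_EFin !lte_fin.
have p1 : (0 < p^-1)%R by rewrite invr_gt0.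
have xK : x = ((x `^ p) `^ p^-1)%R by rewrite -powRrM mulfV ?gt_eqF// powRr1.
have sK : s = ((s `^ p^-1) `^ p)%R by rewrite -powRrM mulVf ?gt_eqF// powRr1.
apply/idP/idP => H.
- by rewrite {1}xK gt0_ltr_powR// nnegrE// powR_ge0.
- by rewrite {1}sK gt0_ltr_powR// nnegrE// powR_ge0.
Qed.

Section initial_sets.
Context (R : realType).
Implicit Types (D : set R) (c s t : R).
Local Notation leb := (@lebesgue_measure R).

(** The endpoint [c] is the supremum of [D], or 0 if [D] is empty. Whether [c] belongs to [D] is
    left open, hence the two inclusions. *)
Lemma initial_set_itv D : D `<=` `]0%R, 1%R] ->
  (forall s t, (0 < s)%R -> (s <= t)%R -> D t -> D s) ->
  exists c, [/\ (0 <= c <= 1)%R, `]0%R, c[ `<=` D & D `<=` `]0%R, c]].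
Proof.
move=> D01 Dd; have [[t0 Dt0]|D0] := pselect (D !=set0); last first.
  exists 0%R; split; first by rewrite lexx ler01.
    by move=> x /=; rewrite in_itv/=; lra.
  by move=> x Dx; exfalso; apply: D0; exists x.
have hD : has_sup D.
  by split; [exists t0|exists 1%R => x /D01/=; rewrite in_itv/= => /andP[]].
have Dsup x : D x -> (x <= sup D)%R by apply: sup_upper_bound.
exists (sup D); split.
- apply/andP; split.
    by apply: le_trans (Dsup _ Dt0); move: (D01 _ Dt0); rewrite /= in_itv/=; lra.
  by apply: ge_sup; [exists t0|move=> x /D01/=; rewrite in_itv/= => /andP[]].
- move=> x /=; rewrite in_itv/= => /andP[x0 xs].
  have [|y Dy xy] := @sup_gt _ D x _ xs; first by exists t0.
  exact: Dd x0 (ltW xy) Dy.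
- move=> x Dx /=; rewrite in_itv/= Dsup// andbT.
  by move: (D01 _ Dx); rewrite /= in_itv/=; lra.
Qed.

Lemma initial_set_measurable D : D `<=` `]0%R, 1%R] ->
  (forall s t, (0 < s)%R -> (s <= t)%R -> D t -> D s) -> measurable D.
Proof.
move=> D01 Dd; apply: is_interval_measurable => x y Dx Dy z /andP[xz zy].
by apply: Dd zy Dy; move: (D01 _ Dx); rewrite /= in_itv/=; lra.
Qed.

Lemma lebesgue_measure_between D c : (0 <= c)%R -> measurable D ->
  `]0%R, c[ `<=` D -> D `<=` `]0%R, c] -> leb D = c%:E.
Proof.
move=> c0 mD lo up; apply/eqP; rewrite eq_le; apply/andP; split.
  apply: (@le_trans _ _ (leb `]0%R, c])); first by apply: le_measure; rewrite ?inE.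
  by rewrite lebesgue_measure_itv/= lte_fin; case: ifP;
    rewrite ?oppr0 ?adde0 ?lee_fin.
apply: (@le_trans _ _ (leb `]0%R, c[)); last by apply: le_measure; rewrite ?inE.
rewrite lebesgue_measure_itv/= lte_fin; case: ltP; rewrite ?oppr0 ?adde0 ?lee_fin//.
Qed.

Lemma lebesgue_measure_oc (t : R) : (0 <= t)%R -> leb `]0%R, t] = t%:E.
Proof.
move=> t0; apply: lebesgue_measure_between => // x /=; rewrite !in_itv/=; lra.
Qed.

End initial_sets.

(** * The averages of [g] over initial intervals *)

Section average.
Context (R : realType) (g : R -> R).
Hypothesis g_ge0 : forall t : R, (0 < t <= 1)%R -> (0 <= g t)%R.
Hypothesis g_mono : forall s t : R, (0 < s)%R -> (s <= t)%R -> (t <= 1)%R ->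
  (g t <= g s)%R.
Hypothesis g_int : (@lebesgue_measure R).-integrable `]0%R, 1%R] (EFin \o g).
Implicit Types (s t c : R).
Local Notation leb := (@lebesgue_measure R).

Definition average t : \bar R :=
  (t^-1)%:E * \int[leb]_(u in `]0%R, t]) (g u)%:E.

Lemma oc_sub t : (t <= 1)%R -> `]0%R, t] `<=` `]0%R, 1%R].
Proof. by move=> t1 x /=; rewrite !in_itv/=; lra. Qed.

Lemma g_measurable t : (t <= 1)%R -> measurable_fun `]0%R, t] (EFin \o g).
Proof.
move=> t1; apply: measurable_funS (measurable_int _ g_int) => //.
exact: oc_sub.
Qed.

(** As [g] is non-increasing, [{g > s}] is an initial interval, and its length [c] describes it up
    to the endpoint. Both bounds use [g] through these levels. *)
Lemma g_level s : exists c, [/\ (0 <= c <= 1)%R,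
  forall t, (0 < t < c)%R -> (s < g t)%R,
  forall t, (0 < t <= 1)%R -> (s < g t)%R -> (t <= c)%R &
  forall t, (0 <= t <= 1)%R ->
    leb (`]0%R, t] `&` [set u | s%:E < (g u)%:E]) = (Num.min t c)%:E].
Proof.
pose D := `]0%R, 1%R] `&` [set u | s%:E < (g u)%:E].
have Dd x y : (0 < x)%R -> (x <= y)%R -> D y -> D x.
  move=> x0 xy [/=]; rewrite in_itv/= lte_fin => y1 sy; split => /=.
    by rewrite in_itv/= x0/= (le_trans xy)//; case/andP: y1.
  by rewrite lte_fin (lt_le_trans sy)// g_mono//; case/andP: y1.
have [c [/andP[c0 c1] lo up]] := initial_set_itv (@subIsetl _ _ _) Dd.
exists c; split.
- by rewrite c0.
- by move=> t tc; have [] := lo t _; rewrite /= ?in_itv//= lte_fin.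
- move=> t t1 st; have /up : D t by split; rewrite /= ?in_itv/= ?lte_fin.
  by rewrite /= in_itv/= => /andP[].
- move=> t /andP[t0 t1].
  rewrite (_ : _ `&` _ = D `&` `]0%R, t]); last first.
    rewrite /D setIAC; congr (_ `&` _); rewrite setIC; apply/esym/setIidl.
    exact: oc_sub.
  apply: lebesgue_measure_between.
  + by rewrite le_min t0.
  + by apply: measurableI => //; apply: initial_set_measurable Dd => x [].
  + move=> x /=; rewrite in_itv/= lt_min => /andP[x0 /andP[xt xc]]; split.
      by apply: lo; rewrite /= in_itv/= x0.
    by rewrite /= in_itv/= x0 ltW.
  + by move=> x [/up]; rewrite /= !in_itv/= le_min => /andP[-> ->] /andP[_ ->].
Qed.

(** By levels, with [c] the length of [{g > l}], this is [min t c <= (t / s) * min s c]: the ratio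
    [min x c / x] is non-increasing in [x]. *)
Lemma average_mono s t : (0 < s)%R -> (s <= t)%R -> (t <= 1)%R ->
  average t <= average s.
Proof.
move=> s0 st t1; have t0 : (0 < t)%R by exact: lt_le_trans st.
rewrite /average lee_pdivrMl// muleA -EFinM.
apply: le_integral_superlevel => //.
- exact: g_measurable.
- by apply: g_measurable; exact: le_trans t1.
- by move=> x /=; rewrite in_itv/= lee_fin => /andP[x0 xt];
  rewrite g_ge0// x0 (le_trans xt).
- move=> x /=; rewrite in_itv/= lee_fin => /andP[x0 xt];
  rewrite g_ge0// x0 (le_trans xt)//.
  exact: le_trans t1.
- by rewrite divr_ge0// ltW.
- move=> l l0; have [c [/andP[c0 c1] _ _ H]] := g_level l.
  rewrite [X in X <= _](_ : _ = (Num.min t c)%:E); last by apply: H; lra.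
  rewrite [X in _ * X](_ : _ = (Num.min s c)%:E); last by apply: H; lra.
  rewrite -EFinM lee_fin mulrAC ler_pdivlMr//.
  by case: (ltP t c) => tc; case: (ltP s c) => sc; nra.
Qed.

Lemma average_ge0 t : (0 < t <= 1)%R -> 0 <= average t.
Proof.
move=> /andP[t0 t1]; rewrite mule_ge0// ?lee_fin ?invr_ge0 ?(ltW t0)//.
apply: integral_ge0 => x /=; rewrite in_itv/= lee_fin => /andP[x0 xt].
by rewrite g_ge0// x0 (le_trans xt).
Qed.

Lemma average_measurable : measurable_fun (`]0%R, 1%R]%classic : set
  (measurableTypeR R)) average.
Proof.
apply: emeasurable_fun_gt => r; apply: initial_set_measurable; first by move=> x [].
move=> s t s0 st [/=]; rewrite in_itv/= => /andP[_ t1] rt; split => /=.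
  by rewrite in_itv/= s0 (le_trans st).
by rewrite (lt_le_trans rt)// average_mono.
Qed.

End average.

(** * The upper bound for every admissible function *)

Section upper_bound.
Context d (X : measurableType d) (R : realType) (mu : probability X R).
Variables (Tr : set (set X)) (ch : set X -> nat -> set X).
Hypothesis HT : indexed_tree mu Tr ch.
Variable g : R -> R.
Hypothesis g_ge0 : forall t : R, (0 < t <= 1)%R -> (0 <= g t)%R.
Hypothesis g_mono : forall s t : R, (0 < s)%R -> (s <= t)%R -> (t <= 1)%R ->
  (g t <= g s)%R.
Hypothesis g_int : (@lebesgue_measure R).-integrable `]0%R, 1%R] (EFin \o g).
Variable phi : X -> R.
Hypothesis phi_meas : measurable_fun setT phi.
Hypothesis phi_ge0 : forall x, (0 <= phi x)%R.
Hypothesis phi_rearr : {ae @lebesgue_measure R, forall t : R, (0 < t <= 1)%R ->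
  rearrangement mu phi t = (g t)%:E}.
Local Notation leb := (@lebesgue_measure R).

Let ephi_meas : measurable_fun setT (fun x => (phi x)%:E).
Proof. exact/measurable_EFinP. Qed.

(** If [{phi > s'}] had measure [r > c] for some [s' > s], the rearrangement would be at least [s']
    on []c, r[], where [g <= s]. The whole interval would then lie in the null set excluded by
    [phi_rearr]. *)
Lemma superlevel_rearrangement (s c : R) : (0 <= s)%R -> (0 <= c <= 1)%R ->
  (forall t, (0 < t <= 1)%R -> (s < g t)%R -> (t <= c)%R) ->
  mu (setT `&` [set x | s%:E < (phi x)%:E]) <= c%:E.
Proof.
move=> s0 /andP[c0 c1] gc.
apply: measure_superlevel_rcont => // s' ss'.
rewrite leNgt; apply/negP; set E := setT `&` _ => cE.
have mE : measurable E by exact: emeasurable_fun_o_infty.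
set r := fine (mu E); have rE : r%:E = mu E by rewrite fine_measureK.
have cr : (c < r)%R by rewrite -lte_fin rE.
have r1 : (r <= 1)%R by rewrite -lee_fin rE probability_le1.
have [A [mA A0 sA]] := phi_rearr.
have : leb `]c, r[ <= leb A.
  apply: le_measure; rewrite ?inE// => t /=; rewrite in_itv/= => /andP[ct tr].
  apply: sA => /= H; have t1 : (0 < t <= 1)%R by lra.
  have : s'%:E <= rearrangement mu phi t.
    apply: le_ereal_inf_tmp => _ [u [u0 ut] <-]; rewrite lee_fin leNgt;
      apply/negP => us'.
    move: tr; rewrite ltNge -lee_fin rE => /negP; apply; apply: le_trans ut.
    apply: le_measure; rewrite ?inE//.
      rewrite (_ : [set x | _] = setT `&` [set x | u%:E < (phi x)%:E]).
        exact: emeasurable_fun_o_infty.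
      by rewrite setTI; apply/seteqP; split => x /=; rewrite ger0_norm// lte_fin.
    by move=> x [_ /=]; rewrite lte_fin ger0_norm//; exact: lt_trans.
  rewrite (H t1) lee_fin => /(lt_le_trans ss') /(gc _ t1).
  by rewrite leNgt ct.
by rewrite A0 lebesgue_measure_itv/= lte_fin cr -EFinB lee_fin; lra.
Qed.

(** The Hardy-Littlewood inequality by levels: [E] meets [{phi > s}] in measure at most [min t c],
    which is what []0, t]] attains for [g]. *)
Lemma integral_le_rearrangement (E : set X) (t : R) :
  measurable E -> mu E = t%:E ->
  \int[mu]_(x in E) (phi x)%:E <= \int[leb]_(u in `]0%R, t]) (g u)%:E.
Proof.
move=> mE Et; have t0 : (0 <= t)%R by rewrite -lee_fin -Et.
have t1 : (t <= 1)%R by rewrite -lee_fin -Et probability_le1.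
rewrite -[leRHS]mul1e; apply: le_integral_superlevel => //.
- exact: measurable_funTS.
- exact: g_measurable.
- by move=> x _; rewrite lee_fin.
- by move=> u /=; rewrite in_itv/= lee_fin => /andP[u0 ut];
  rewrite g_ge0// u0 (le_trans ut).
- move=> s s0; rewrite mul1e.
  have [c [c01 _ gc H]] := g_level g_mono s.
  rewrite [leRHS](_ : _ = (Num.min t c)%:E); last by apply: H; lra.
  have mEs : measurable (E `&` [set x | s%:E < (phi x)%:E]).
    by apply: emeasurable_fun_o_infty => //; exact: measurable_funTS.
  rewrite EFin_min le_min -Et; apply/andP; split.
    by apply: le_measure; rewrite ?inE//; exact: subIsetl.
  apply: le_trans (superlevel_rearrangement s0 c01 gc).
  apply: le_measure; rewrite ?inE//; first exact: emeasurable_fun_o_infty.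
  exact: setSI.
Qed.

(** With [r] the measure of [{M phi > l'}] and [l' > l], the weak type inequality and
    Hardy-Littlewood give [l' <= average g r], so all of []0, r]] lies in [{average g > l}]. *)
Lemma maximal_superlevel_le (l : R) : (0 <= l)%R ->
  mu (setT `&` [set x | l%:E < dyadic_maximal mu Tr phi x]) <=
  leb (`]0%R, 1%R] `&` [set t | l%:E < average g t]).
Proof.
move=> l0; apply: measure_superlevel_rcont => //.
  exact: (maximal_measurable HT).
move=> l' ll'; rewrite setTI; set E := [set x | _].
have mE : measurable E.
  rewrite -[E]setTI; apply: emeasurable_fun_o_infty => //.
  exact: (maximal_measurable HT).
have rE := fine_measureK mu mE; set r := fine (mu E) in rE.
have [r0|r0] := leP r 0%R; first by apply: le_trans (measure_ge0 _ _);
  rewrite [leLHS](_ : _ = r%:E)// lee_fin.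
have r1 : (r <= 1)%R by rewrite -lee_fin rE probability_le1.
have lr : l'%:E <= average g r.
  rewrite /average lee_pdivlMl// muleC rE;
    apply: le_trans (integral_le_rearrangement mE (esym rE)).
  apply: (le_trans (maximal_weak_type HT (ltW (le_lt_trans l0 ll')) phi_meas)).
  by apply: le_trans (_ : _ <= _) => //; under eq_integral do rewrite ger0_norm//.
rewrite [leLHS](_ : _ = r%:E)// -(lebesgue_measure_oc (ltW r0));
  apply: le_measure; rewrite ?inE//.
  apply: emeasurable_fun_o_infty => //; exact: average_measurable.
move=> t /=; rewrite in_itv/= => /andP[t0 tr]; split => /=.
  by rewrite in_itv/= t0 (le_trans tr).
apply: (@lt_le_trans _ _ l'%:E); first by rewrite lte_fin.
by apply: (le_trans lr); exact: average_mono.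
Qed.

Lemma maximal_le_average (p : R) : (0 < p)%R ->
  \int[mu]_x (dyadic_maximal mu Tr phi x `^ p) <=
  \int[leb]_(t in `]0%R, 1%R]) (average g t `^ p).
Proof.
move=> p0; rewrite -[leRHS]mul1e; apply: le_integral_superlevel => //.
- apply: (measurableT_comp (measurable_poweR p)); exact: (maximal_measurable HT).
- apply: (measurableT_comp (measurable_poweR p)); exact: average_measurable.
- by move=> x _; exact: poweR_ge0.
- by move=> x _; exact: poweR_ge0.
- move=> s s0; rewrite mul1e.
  rewrite (_ : setT `&` _ = setT `&` [set x | (s `^ p^-1)%:E < dyadic_maximal
    mu Tr phi x]).
    rewrite (_ : `]0%R, 1%R] `&` _ = `]0%R, 1%R] `&` [set t | (s `^ p^-1)%:E <
      average g t]).
      by apply: maximal_superlevel_le; exact: powR_ge0.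
    apply/seteqP; split => t /= [t01]; rewrite lt_poweR_root//;
      by apply: average_ge0 => //; move: t01; rewrite in_itv.
  by apply/seteqP; split => x /= [_]; rewrite lt_poweR_root// (maximal_ge0 HT).
Qed.

End upper_bound.

(** * A nearly extremal function built from a spread *)

Section lower_bound.
Context d (X : measurableType d) (R : realType) (mu : probability X R).
Variables (Tr : set (set X)) (ch : set X -> nat -> set X).
Hypothesis HT : indexed_tree mu Tr ch.
Variable g : R -> R.
Hypothesis g_ge0 : forall t : R, (0 < t <= 1)%R -> (0 <= g t)%R.
Hypothesis g_mono : forall s t : R, (0 < s)%R -> (s <= t)%R -> (t <= 1)%R ->
  (g t <= g s)%R.
Hypothesis g_int : (@lebesgue_measure R).-integrable `]0%R, 1%R] (EFin \o g).
Variables (q : R) (N : nat) (B : R -> set X).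
Hypothesis q01 : (0 < q < 1)%R.
Hypothesis HB : spread mu Tr q N setT B.
Local Notation leb := (@lebesgue_measure R).

(** The constraint [0 <= t] bounds the set below, and [B 1], being everything, makes it nonempty. *)
Definition entry (x : X) : R := inf [set t : R | (0 <= t)%R /\ B t x].

(** The entry time can be 0, where nothing is known of [g]; the value there is 0. *)
Definition spread_fun (x : X) : R := (g \_ `]0%R, 1%R]) (entry x).

Lemma spread1 (t : R) x : (1 <= t)%R -> B t x.
Proof. by move=> /(sp_mono HB); rewrite (sp_full HB); exact. Qed.

Lemma entry_has_inf x : has_inf [set t : R | (0 <= t)%R /\ B t x].
Proof.
split; first by exists 1%R; split; rewrite ?ler01//; exact: spread1.
by exists 0%R => t [].
Qed.

Lemma entry_le (t : R) x : (0 <= t)%R -> B t x -> (entry x <= t)%R.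
Proof. by move=> t0 Btx; apply: ge_inf => //; exact: (entry_has_inf x).2. Qed.

Lemma entry_ge (t : R) x : ~ B t x -> (t <= entry x)%R.
Proof.
move=> nBt; apply: lb_le_inf; first exact: (entry_has_inf x).1.
move=> u [u0 Bu]; rewrite leNgt; apply/negP => ut; apply: nBt.
exact: (sp_mono HB (ltW ut)) Bu.
Qed.

Lemma entry_lt (t : R) x : (entry x < t)%R -> B t x.
Proof. by move=> et; apply: contrapT => /entry_ge; rewrite leNgt et. Qed.

Lemma entry_itv x : (0 <= entry x <= 1)%R.
Proof.
apply/andP; split; last by apply: entry_le => //; exact: spread1.
by apply: lb_le_inf; [exact: (entry_has_inf x).1|move=> t []].
Qed.

Lemma entry_measurable : measurable_fun setT entry.
Proof.
apply: (measurability _ (RGenInftyO.measurableE R)) => _ [_ [t ->] <-].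
(* Rational times suffice: if [entry x < t], then [x] already belongs to [B] at any rational time in
   between. *)
rewrite setTI [X in measurable X](_ : _ =
  \bigcup_(r : rat) [set x | ((0 <= ratr r :> R) && (ratr r < t :> R))%R /\ B
    (ratr r) x]).
  apply: countable_bigcupT_measurable => [|r]; first exact: countableP.
  case: (_ && _); last by rewrite (_ : [set _ | _] = set0)//; apply/seteqP;
    split => x [].
  rewrite (_ : [set _ | _] = B (ratr r)); first exact: (sp_measurable HB).
  by apply/seteqP; split => x // [].
apply/seteqP; split => x /=; rewrite in_itv/=.
  move=> xt; have [r] := rat_in_itvoo xt; rewrite in_itv/= => /andP[xr rt].
  exists r => //; split; last exact: entry_lt.
  by rewrite rt andbT (le_trans _ (ltW xr))//; case/andP: (entry_itv x).
by move=> [r _ [/andP[r0 rt] Br]]; exact: le_lt_trans (entry_le r0 Br) rt.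
Qed.

Lemma spread_fun_measurable : measurable_fun setT spread_fun.
Proof.
apply: (@measurableT_comp _ _ _ _ _ _ (g \_ `]0%R, 1%R]) _ entry) => //; last first.
  exact: entry_measurable.
have mg : measurable_fun (`]0%R, 1%R]%classic : set (measurableTypeR R)) g.
  by apply/measurable_EFinP; exact: (measurable_int _ g_int).
exact: (iffLR (measurable_restrictT _ _) mg).
Qed.

Lemma spread_fun_ge0 x : (0 <= spread_fun x)%R.
Proof.
rewrite /spread_fun patchE; case: ifPn => //; rewrite inE /= in_itv/=.
exact: g_ge0.
Qed.

Lemma spread_measure_le (t : R) : (0 <= t)%R -> mu (B t) <= t%:E.
Proof.
move=> t0; have [t1|t1] := leP t 1%R.
  by rewrite (sp_measure HB) ?t0// probability_setT mule1.
apply: (@le_trans _ _ 1); last by rewrite lee_fin ltW.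
by apply: probability_le1; exact: (sp_measurable HB).
Qed.

Let esf_meas : measurable_fun setT (fun x => (spread_fun x)%:E).
Proof. by apply/measurable_EFinP; exact: spread_fun_measurable. Qed.

Let superlevel_measurable (s : R) : measurable [set x | s%:E < (spread_fun x)%:E].
Proof.
by rewrite -[X in measurable X]setTI; exact: emeasurable_fun_o_infty.
Qed.

(** Points where the function exceeds [s] enter by time [c], hence lie in [B (c + e)]. The slack [e]
    is there because [B] need not be right-continuous. *)
Lemma spread_superlevel_le (s c : R) : (0 <= s)%R -> (0 <= c)%R ->
  (forall t, (0 < t <= 1)%R -> (s < g t)%R -> (t <= c)%R) ->
  mu [set x | s%:E < (spread_fun x)%:E] <= c%:E.
Proof.
move=> s0 c0 gc; apply/lee_addgt0Pr => e e0; rewrite -EFinD.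
have ce0 : (0 <= c + e)%R by lra.
apply: le_trans (spread_measure_le ce0).
apply: le_measure; rewrite ?inE//; first exact: (sp_measurable HB).
move=> x /=; rewrite lte_fin /spread_fun patchE; case: ifPn.
  by rewrite inE/= in_itv/= => x01 /(gc _ x01) xc; apply: entry_lt; lra.
by move=> _; rewrite ltNge s0.
Qed.

(** Points of [K] in [B t] but not in [B e] enter between [e] and [t]; if [0 < e] and [t < c], the
    function exceeds [s] there. *)
Lemma spread_superlevel_ge (K : set X) (a s c : R) : measurable K ->
  (0 < a <= 1)%R -> (0 <= c)%R ->
  (forall t, (0 <= t <= a)%R -> mu (B t `&` K) = (t / a)%:E * mu K) ->
  (forall t, (0 < t < c)%R -> (s < g t)%R) ->
  (Num.min a c / a)%:E * mu K <= mu (K `&` [set x | s%:E < (spread_fun x)%:E]).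
Proof.
move=> mK /andP[a0 a1] c0 BK cg; set b := Num.min a c.
have b0 : (0 <= b)%R by rewrite le_min (ltW a0).
have ba : (b <= a)%R by rewrite ge_min lexx.
have bc : (b <= c)%R by rewrite ge_min lexx orbT.
apply/lee_mul01Pr; first by rewrite mule_ge0// lee_fin divr_ge0// ltW.
move=> r /andP[r0 r1]; rewrite muleA -EFinM.
have [->|bn0] := eqVneq b 0%R; first by rewrite mul0r mulr0 mul0e.
have {}b0 : (0 < b)%R by rewrite lt_neqAle eq_sym bn0.
(* Chosen so that [t - e = r * b] with [0 < e <= t < b]; letting [r] tend to 1 recovers the full
   share [b / a] of [K]. *)
pose t := (b * (1 + r) / 2)%R; pose e := (b * (1 - r) / 2)%R.
have e0 : (0 < e)%R by rewrite /e; nra.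
have et : (e <= t)%R by rewrite /e /t; nra.
have tb : (t < b)%R by rewrite /t; nra.
have teE : (r * (b / a) = t / a - e / a)%R by rewrite /t /e; field; rewrite gt_eqF.
have mL : measurable (K `&` [set x | s%:E < (spread_fun x)%:E]) by exact:
  measurableI.
have mBK u : measurable (B u `&` K) by apply: measurableI => //;
  exact: (sp_measurable HB).
rewrite teE EFinB muleBl ?fin_num_measure//.
have t1 : (0 <= t <= a)%R by lra.
have e1 : (0 <= e <= a)%R by lra.
rewrite -(BK _ t1) -(BK _ e1).
rewrite leeBlDr ?fin_num_measure//.
apply: le_trans (measureU2 _ _ _) => //.
apply: le_measure; rewrite ?inE//; first exact: measurableU.
move=> x [Btx Kx]; have [Bex|nBex] := pselect (B e x); first by right.
left; split => //=; rewrite lte_fin /spread_fun.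
have xe := entry_ge nBex; have xt : (entry x <= t)%R by apply: entry_le => //; lra.
rewrite patchE ifT; last by rewrite inE/= in_itv/=; lra.
by apply: cg; lra.
Qed.

(** By levels: in the node [K] around [x], [{spread_fun > s}] has relative measure at least
    [min a c / a], the share of [{g > s}] in []0, a]], where [a = q ^+ m]. *)
Lemma average_le_maximal m x : (m <= N)%N -> B (q ^+ m)%R x ->
  average g (q ^+ m)%R <= dyadic_maximal mu Tr spread_fun x.
Proof.
move=> mN Bx; have [K [TK Kx _ BK]] := sp_node HB mN Bx.
have /andP[q0 q1] := q01; have a0 : (0 < q ^+ m)%R by rewrite exprn_gt0.
have a1 : (q ^+ m <= 1)%R by rewrite exprn_ile1// ltW.
move: (q ^+ m)%R a0 a1 BK => a a0 a1 BK {Bx mN}.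
apply: (@le_trans _ _ ((\int[mu]_(y in K) `|spread_fun y|%:E) / mu K)); last first.
  by apply: ereal_sup_ubound; exists K.
have mK := it_measurable HT TK.
have Kf : mu K \is a fin_num by rewrite fin_num_measure.
have k0 : (0 < fine (mu K))%R by rewrite fine_gt0// (it_gt0 HT TK)/= ltey_eq Kf.
rewrite -(fineK Kf) inver gt_eqF// lee_pdivlMr// /average -muleA lee_pdivrMl//
  muleC.
rewrite -lee_pdivlMl// muleA -EFinM.
apply: le_integral_superlevel => //.
- exact: g_measurable.
- apply/measurable_funTS; apply/measurable_EFinP; apply: measurableT_comp => //.
  exact: spread_fun_measurable.
- by move=> x0 /=; rewrite in_itv/= lee_fin => /andP[y0 ya];
  rewrite g_ge0// y0 (le_trans ya).
- by rewrite mulr_ge0 ?invr_ge0// ltW.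
- move=> s s0; have [c [/andP[c0 c1] cg _ H]] := g_level g_mono s.
  rewrite [leLHS](_ : _ = (Num.min a c)%:E); last by apply: H; lra.
  rewrite EFinM -muleA lee_pdivlMl//.
  rewrite (_ : [set _ | _] = [set x | s%:E < (spread_fun x)%:E]); last first.
    by apply/seteqP; split => y /=; rewrite ger0_norm ?spread_fun_ge0.
  rewrite -lee_pdivrMl//.
  have := @spread_superlevel_ge K a s c mK; rewrite a0 => /(_ a1 c0 BK cg).
  apply: le_trans; rewrite -[in leRHS](fineK Kf) -!EFinM lee_fin le_eqVlt.
  by apply/orP; left; apply/eqP; ring.
Qed.

Lemma spread_fun_superlevel (s c : R) : (0 <= s)%R -> (0 <= c <= 1)%R ->
  (forall t, (0 < t < c)%R -> (s < g t)%R) ->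
  (forall t, (0 < t <= 1)%R -> (s < g t)%R -> (t <= c)%R) ->
  mu [set x | (s < `|spread_fun x|)%R] = c%:E.
Proof.
move=> s0 /andP[c0 c1] cg gc.
rewrite (_ : [set _ | _] = [set x | s%:E < (spread_fun x)%:E]); last first.
  by apply/seteqP; split => y /=; rewrite ger0_norm ?spread_fun_ge0.
apply/eqP; rewrite eq_le spread_superlevel_le//=.
have := @spread_superlevel_ge setT 1%R s c measurableT.
rewrite setTI ltr01 lexx probability_setT mule1 divr1 min_r// => /(_ isT c0 _
  cg); apply.
by move=> t t1; rewrite setIT divr1 (sp_measure HB)// probability_setT.
Qed.

(** Equality can fail only on a countable set. If the rearrangement at [t] is below [g t], a
    rational level [r] in between has a superlevel set of measure exactly [t]: at least [t] since
    [r < g t], at most [t] by the definition of the infimum. *)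
Lemma rearrangement_spread_fun :
  {ae leb, forall t : R, (0 < t <= 1)%R ->
     rearrangement mu spread_fun t = (g t)%:E}.
Proof.
pose F (r : rat) : R := fine (mu [set x | (ratr r < `|spread_fun x|)%R]).
have cF : countable (range F) by apply: sub_countable (card_image_le _ _) _;
  exact: countableP.
exists (range F); split.
- by apply: countable_measurable => // t; exact: measurable_set1.
- exact: countable_lebesgue_measure0.
move=> t /= H; apply: contrapT => nF; apply: H => /andP[t0 t1].
have gt0 : (0 <= g t)%R by rewrite g_ge0// t0.
apply/eqP; rewrite eq_le; apply/andP; split.
  apply: ereal_inf_lbound; exists (g t) => //; split => //.
  have [c [c01 cg gc _]] := g_level g_mono (g t).
  rewrite [leLHS](_ : _ = c%:E); last exact: spread_fun_superlevel.
  rewrite lee_fin leNgt; apply/negP => tc.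
  by have := cg t; rewrite t0 tc ltxx => /(_ isT).
apply: le_ereal_inf_tmp => _ [s [s0 st] <-]; rewrite lee_fin leNgt;
  apply/negP => sg.
have [r] := rat_in_itvoo sg; rewrite in_itv/= => /andP[sr rg].
have r0 : (0 <= ratr r :> R)%R by rewrite (le_trans s0)// ltW.
have [c [c01 cg gc _]] := g_level g_mono (ratr r).
have Fr := spread_fun_superlevel r0 c01 cg gc.
apply: nF; exists r => //; rewrite /F Fr/=; apply/eqP.
rewrite eq_le gc ?t0// andbT -lee_fin -Fr; apply: le_trans st.
apply: le_measure; rewrite ?inE.
- rewrite (_ : [set _ | _] = [set x | (ratr r)%:E < (spread_fun x)%:E])//.
  by apply/seteqP; split => y /=; rewrite ger0_norm ?spread_fun_ge0.
- rewrite (_ : [set _ | _] = [set x | s%:E < (spread_fun x)%:E])//.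
  by apply/seteqP; split => y /=; rewrite ger0_norm ?spread_fun_ge0.
- by move=> x /=; exact: lt_trans.
Qed.

Lemma spread_fun_integrable : mu.-integrable setT (EFin \o spread_fun).
Proof.
apply/integrableP; split; first exact: esf_meas.
have /integrableP[_] := g_int; apply: le_lt_trans.
rewrite -[leRHS]mul1e; apply: le_integral_superlevel => //.
- apply/measurable_EFinP; apply: measurableT_comp => //;
  exact: spread_fun_measurable.
- apply: measurableT_comp => //; exact: g_measurable.
- move=> s s0; have [c [c01 cg gc H]] := g_level g_mono s.
  have /andP[c0 c1] := c01.
  rewrite mul1e setTI (_ : [set _ | _] = [set x | (s < `|spread_fun x|)%R])//.
  rewrite [leLHS](_ : _ = c%:E); last exact: spread_fun_superlevel.
  have := H 1%R; rewrite ler01 lexx min_r// => <-//.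
  apply: le_measure; rewrite ?inE.
  + by apply: emeasurable_fun_o_infty => //; exact: g_measurable.
  + apply: emeasurable_fun_o_infty => //; apply: measurableT_comp => //.
    exact: g_measurable.
  + move=> x [x1 /= sx]; split => //=; apply: (lt_le_trans sx).
    by rewrite lee_fin ler_norm.
Qed.

(** If [average g t > l] and [q ^+ m.+1 < t <= q ^+ m], then [B (q ^+ m.+1)] lies in [{M > l}],
    whose measure [r] is thus at least [q ^+ m.+1 >= q * t]. So [t <= r / q]. *)
Lemma average_le_maximal_integral (p : R) : (0 < p)%R ->
  \int[leb]_(t in `](q ^+ N)%R, 1%R]) (average g t `^ p) <=
  (q^-1)%:E * \int[mu]_x (dyadic_maximal mu Tr spread_fun x `^ p).
Proof.
move=> p0; have /andP[q0 q1] := q01.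
have qN0 : (0 < q ^+ N)%R by rewrite exprn_gt0.
have sub : `](q ^+ N)%R, 1%R] `<=` `]0%R, 1%R].
  by move=> t /=; rewrite !in_itv/=; lra.
apply: le_integral_superlevel => //.
- apply: (measurableT_comp (measurable_poweR p)).
  by apply: measurable_funS sub _ => //; exact: average_measurable.
- apply: (measurableT_comp (measurable_poweR p)); exact: (maximal_measurable HT).
- by move=> x _; exact: poweR_ge0.
- by move=> x _; exact: poweR_ge0.
- by rewrite invr_ge0 ltW.
move=> s s0; rewrite setTI.
rewrite (_ : [set x | _] = [set x | (s `^ p^-1)%:E < dyadic_maximal mu Tr
  spread_fun x]);
  last by apply/seteqP; split => x /=; rewrite lt_poweR_root// (maximal_ge0 HT).
rewrite (_ : _ `&` _ = `](q ^+ N)%R, 1%R] `&` [set t | (s `^ p^-1)%:E < average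
  g t]);
  last first.
  by apply/seteqP; split => t /= [t01]; rewrite lt_poweR_root//;
    apply: average_ge0 => //; move: (sub _ t01); rewrite /= in_itv.
move: (s `^ p^-1)%R => l {s s0}.
set E := [set x | l%:E < dyadic_maximal _ _ _ x].
have mE : measurable E.
  rewrite -[E]setTI; apply: emeasurable_fun_o_infty => //.
  exact: (maximal_measurable HT).
have rE := fine_measureK mu mE; set r := fine (mu E) in rE.
have r0 : (0 <= r)%R by rewrite fine_ge0.
have qr0 : (0 <= q^-1 * r)%R by rewrite mulr_ge0// invr_ge0 ltW.
rewrite [leRHS](_ : _ = (q^-1 * r)%:E); last by rewrite EFinM rE.
rewrite -(lebesgue_measure_oc qr0); apply: le_measure; rewrite ?inE//.
  apply: emeasurable_fun_o_infty => //.
  by apply: measurable_funS sub _ => //; exact: average_measurable.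
move=> t [/= t01 lt]; move: (t01); rewrite !in_itv/= => /andP[Nt t1].
have t0 : (0 < t)%R by exact: lt_trans Nt.
rewrite t0/= mulrC ler_pdivlMr//.
(* The least exponent is at most [N] since [q ^+ N < t], hence within the depth of the spread, and
   positive since [t <= 1]. *)
have exm : exists m, (q ^+ m < t)%R by exists N.
case: (ex_minnP exm) => -[|m]; first by rewrite expr0 ltNge t1.
move=> mt min; have mN := min _ Nt.
have tm : (t <= q ^+ m)%R by rewrite leNgt; apply/negP => /min; rewrite ltnn.
apply: (@le_trans _ _ (q ^+ m.+1)%R); first by rewrite exprSr ler_wpM2r// ltW.
rewrite -lee_fin rE.
have qm1 : (0 <= q ^+ m.+1 <= 1)%R by rewrite exprn_ge0 ?exprn_ile1// ltW.
have -> : (q ^+ m.+1)%:E = mu (B (q ^+ m.+1)%R).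
  by rewrite (sp_measure HB)// probability_setT mule1.
apply: le_measure; rewrite ?inE//; first exact: (sp_measurable HB).
move=> x Bx; apply: lt_le_trans (average_le_maximal mN Bx).
by apply: (lt_le_trans lt); apply: average_mono => //; rewrite ?exprn_gt0// ltW.
Qed.

End lower_bound.

(** * The two bounds combined *)

Theorem corollary1 (d : measure_display) (X : measurableType d) (R : realType)
    (mu : probability X R) (Hmu : nonatomic mu)
    (Tr : set (set X)) (HTr : is_tree mu Tr)
    (g : R -> R)
    (g_ge0 : forall t : R, (0 < t <= 1)%R -> (0 <= g t)%R)
    (g_mono : forall s t : R, (0 < s)%R -> (s <= t)%R -> (t <= 1)%R ->
       (g t <= g s)%R)
    (g_int : (@lebesgue_measure R).-integrable `]0%R, 1%R] (EFin \o g))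
    (p : R) (p_gt0 : (0 < p)%R) :
  ereal_sup [set \int[mu]_x (dyadic_maximal mu Tr phi x `^ p)
            | phi in [set phi : X -> R |
                [/\ mu.-integrable setT (EFin \o phi),
                    (forall x, (0 <= phi x)%R)
                  & {ae @lebesgue_measure R, forall t : R, (0 < t <= 1)%R ->
                       rearrangement mu phi t = (g t)%:E}]]]
  = \int[@lebesgue_measure R]_(t in `]0%R, 1%R])
      (((t^-1)%:E * \int[@lebesgue_measure R]_(u in `]0%R, t]) (g u)%:E) `^ p).
Proof.
have [ch HT] := tree_indexed HTr.
apply/eqP; rewrite eq_le; apply/andP; split.
  apply: ge_ereal_sup => _ [phi [phi_int phi_ge0 phi_rearr] <-].
  apply: (maximal_le_average HT) => //.
  by apply/measurable_EFinP; exact: (measurable_int _ phi_int).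
(* It suffices to reach [q] times the integral for each [q] in []0, 1[]. *)
apply/lee_mul01Pr; first by apply: integral_ge0 => t _; exact: poweR_ge0.
move=> q q01; have /andP[q0 q1] := q01; rewrite -lee_pdivlMl//.
set S := ereal_sup _.
(* A spread of depth [n] controls only [](q ^+ n), 1]]; these intervals exhaust []0, 1]], and
   monotone convergence passes to the limit. *)
pose F (n : nat) : set R := `](q ^+ n)%R, 1%R]%classic.
have qn n : (0 < q ^+ n)%R by rewrite exprn_gt0.
have Fsub n : F n `<=` `]0%R, 1%R].
  by move=> t; rewrite /F /= !in_itv/=; have := qn n; lra.
have ndF : nondecreasing_seq F.
  move=> m n mn; apply/subsetPset => t; rewrite /F /= !in_itv/= => /andP[mt ->].
  by rewrite andbT (le_lt_trans _ mt)// ler_wiXn2l// ltW.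
have FE : \bigcup_n F n = `]0%R, 1%R]%classic.
  apply/seteqP; split => [t [n _ /Fsub]//|t]; rewrite /= in_itv/= => /andP[t0 t1].
  have : (fun n => q ^+ n)%R @ \oo --> (0 : R)%R.
    by apply: cvg_expr; rewrite ger0_norm// ltW.
  move=> /cvgr0Pnorm_lt /(_ t t0)[n _ /(_ n (leqnn n))] /=.
  rewrite ger0_norm ?(ltW (qn n))// => nt.
  by exists n => //; rewrite /F /= in_itv/= nt.
have mA n : measurable_fun (F n : set (measurableTypeR R)) (fun t => average g
  t `^ p).
  apply: (measurableT_comp (measurable_poweR p)).
  by apply: measurable_funS (Fsub n) _ => //; exact: average_measurable.
have cF : \int[@lebesgue_measure R]_(t in F n) (average g t `^ p) @[n --> \oo] -->
    \int[@lebesgue_measure R]_(t in `]0%R, 1%R]) (average g t `^ p).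
  rewrite -FE; apply: ge0_nondecreasing_set_cvg_integral => //.
    by move=> n; exact: measurable_itv.
  by move=> n t _; exact: poweR_ge0.
rewrite -(cvg_lim _ cF)//; apply: lime_le; first exact: cvgP cF.
apply: nearW => N.
(* The test function depends on [N], but the bound by the supremum [S] does not. *)
have [B HB] := exists_spread HT N q01 (it_root HT).
apply: (le_trans (average_le_maximal_integral HT g_ge0 g_mono g_int q01 HB p_gt0)).
apply: lee_wpmul2l; first by rewrite lee_fin invr_ge0 ltW.
apply: ereal_sup_ubound; exists (spread_fun g B) => //; split.
- exact: (spread_fun_integrable g_ge0 g_mono g_int HB).
- by move=> x; exact: spread_fun_ge0.
- exact: (rearrangement_spread_fun g_ge0 g_mono g_int HB).
Qed.
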